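(* Let $n$ be a natural number. The star graph $S_n=T_{n+1,1}$ is determined by its spectrum if and only if $n$ is prime.
   Context: All graphs are finite, simple and undirected; natural numbers are positive. $S_n=K_{1,n}$ is the star with $n+1$ vertices, i.e. $S_n=T_{n+1,1}=K_1\lor\overline{K_n}$, where $K_m$ is the complete graph on $m$ vertices, $\overline{K_m}$ is the empty graph (no edges) on $m$ vertices, and the join $G_1\lor G_2$ is obtained from the disjoint union of $G_1$ and $G_2$ by connecting every vertex of $G_1$ to every vertex of $G_2$. The spectrum of a graph is the multiset of eigenvalues (with multiplicity) of its $(0,1)$ adjacency matrix. Two graphs are cospectral if they have the same spectrum. A graph is determined by its spectrum (DS) if every graph cospectral with it is isomorphic to it.
   Formalization: The case n = 1 is excluded (n is assumed greater than 1): S_1 = K_2 is determined by its spectrum although 1 is not prime, so the stated equivalence fails there. *)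

(* Defs.v *)
From HB Require Import structures.
From mathcomp Require Import all_boot all_order all_algebra all_field.

Set Implicit Arguments.
Unset Strict Implicit.
Unset Printing Implicit Defensive.

Import GRing.Theory.

Record sgraph := SGraph {
  vertex :> finType;
  adj : rel vertex;
  adj_sym : symmetric adj;
  adj_irrefl : irreflexive adj
}.

Definition isomorphic (G H : sgraph) : Prop :=
  exists2 f : G -> H, bijective f & forall x y, adj (f x) (f y) = adj x y.

Section CompleteGraph.
Variable m : nat.
Let e : rel 'I_m := fun i j => i != j.
Let e_sym : symmetric e. Proof. by move=> i j; rewrite /e eq_sym. Qed.
Let e_irrefl : irreflexive e. Proof. by move=> i; rewrite /e eqxx. Qed.
Definition complete_graph : sgraph := SGraph e_sym e_irrefl.
End CompleteGraph.

Section EmptyGraph.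
Variable m : nat.
Let e : rel 'I_m := fun _ _ => false.
Let e_sym : symmetric e. Proof. by []. Qed.
Let e_irrefl : irreflexive e. Proof. by []. Qed.
Definition empty_graph : sgraph := SGraph e_sym e_irrefl.
End EmptyGraph.

Section Join.
Variables G H : sgraph.
Let e : rel (G + H)%type := fun u v =>
  match u, v with
  | inl x, inl y => adj x y
  | inr x, inr y => adj x y
  | _, _ => true
  end.
Let e_sym : symmetric e.
Proof. by move=> [x|x] [y|y] //=; rewrite adj_sym. Qed.
Let e_irrefl : irreflexive e.
Proof. by move=> [x|x] /=; rewrite adj_irrefl. Qed.
Definition join : sgraph := SGraph e_sym e_irrefl.
End Join.

Definition star (n : nat) : sgraph := join (complete_graph 1) (empty_graph n).

(* Rows and columns are indexed through the enumeration of the vertices; any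
   other ordering gives a similar matrix, hence the same eigenvalues. *)
Definition adjacency_mx (G : sgraph) : 'M[algC]_#|G| :=
  \matrix_(i, j) (adj (enum_val i) (enum_val j))%:R%R.

(* The roots of the characteristic polynomial with multiplicity. As a list it is
   only meaningful up to permutation. The adjacency matrix is real symmetric, so
   all the roots are real and algebraic and geometric multiplicities agree. *)
Definition spectrum (G : sgraph) : seq algC :=
  sval (closed_field_poly_normal (char_poly (adjacency_mx G))).

Definition cospectral (G H : sgraph) : Prop :=
  perm_eq (spectrum G) (spectrum H).

Definition determined_by_spectrum (G : sgraph) : Prop :=
  forall H : sgraph, cospectral H G -> isomorphic H G.

(* Main.v *)
(* Let A be the adjacency matrix of G. By the spectral theorem, G is cospectral
   to the star iff it has n + 1 vertices, A^3 = n A and tr A^2 = 2 n, that is,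
   iff x and y are joined by n walks of length 3 when they are adjacent and by
   none otherwise, and G has n edges. In such a graph there are no triangles
   (tr A^3 = n tr A = 0), and counting the walks of length 3 along an edge xy
   shows that the edges of G are exactly the pairs in N(x) * N(y): G is a
   complete bipartite graph with deg x * deg y = n plus isolated vertices. *)

Require Import Defs.
From mathcomp Require Import all_boot all_order all_algebra all_field.
From mathcomp Require Import perm ring.

Set Implicit Arguments.
Unset Strict Implicit.
Unset Printing Implicit Defensive.

Import Order.TTheory GRing.Theory Num.Theory.

(** * Characteristic polynomials and power sums *)

Section Spectrum.
Local Open Scope ring_scope.

Lemma char_poly_conj (F : fieldType) m (P A : 'M[F]_m) :
  P \in unitmx -> char_poly (invmx P *m A *m P) = char_poly A.
Proof.
move=> uP; rewrite /char_poly.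
have -> : char_poly_mx (invmx P *m A *m P) =
    map_mx polyC (invmx P) *m char_poly_mx A *m map_mx polyC P.
  rewrite /char_poly_mx mulmxBr mulmxBl scalar_mxC -!mulmxA -!map_mxM.
  by rewrite mulVmx // map_mx1 mulmx1.
rewrite !det_mulmx mulrAC -det_mulmx -map_mxM mulVmx //.
by rewrite map_mx1 det1 mul1r.
Qed.

(** Since [c != 0], the cubic has three distinct roots, and their multiplicities in a list solve a
    linear system whose data are the power sums of order 0, 1 and 2. *)
Lemma perm_eq_of_moments (c : algC) (s t : seq algC) : c != 0 ->
    (forall z, z \in s -> z ^+ 3 = c * z) ->
    (forall z, z \in t -> z ^+ 3 = c * z) ->
    size s = size t -> \sum_(z <- s) z = \sum_(z <- t) z ->
    \sum_(z <- s) z ^+ 2 = \sum_(z <- t) z ^+ 2 ->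
  perm_eq s t.
Proof.
move=> c0 hs ht e0 e1 e2; apply/allP => a ast /=.
have ha : a ^+ 3 = c * a.
  by move: ast; rewrite mem_cat => /orP[/hs|/ht].
have c2 : c *+ 2 != 0 by rewrite mulrn_eq0.
(* Lagrange interpolation on the roots of [X^3 - c X]: the indicator function
   of a root is a quadratic polynomial. *)
have [k0 [k1 [k2 hk]]] : exists k0 k1 k2, forall z, z ^+ 3 = c * z ->
    (z == a)%:R = k0 + k1 * z + k2 * z ^+ 2.
  have sq z : z ^+ 3 = c * z -> z = 0 \/ z ^+ 2 = c.
    move=> hz; have [->|z0] := eqVneq z 0; [by left | right].
    by apply: (mulIf z0); rewrite -exprSr.
  case: (sq _ ha) => ea.
    exists 1, 0, (- c^-1) => z /sq[->|ez]; rewrite ea ?eqxx /=; first by field.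
    have /negbTE -> : z != 0.
      by apply: contraNneq c0 => z0; rewrite -ez z0 expr0n.
    by rewrite ez /=; field.
  have a0 : a != 0 by apply: contraNneq c0 => a0; rewrite -ea a0 expr0n.
  (* Here [a ^+ 2 = c], and z (z + a) / (2 c) vanishes at 0 and -a and equals 1 at a. *)
  exists 0, (a / (c *+ 2)), (1 / (c *+ 2)) => z /sq[->|ez].
    by rewrite eq_sym (negbTE a0) /=; field.
  have [->|za] := eqVneq z a; first by rewrite -ea /=; field.
  have -> : z = - a.
    apply/eqP; move/eqP: ez; rewrite -ea eqf_sqr (negbTE za).
    by [].
  by rewrite -ea /=; field.
have cnt r : (forall z, z \in r -> z ^+ 3 = c * z) ->
    (count_mem a r)%:R = k0 * (size r)%:R + k1 * (\sum_(z <- r) z)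
      + k2 * \sum_(z <- r) z ^+ 2.
  move=> hr; rewrite -sum1_count natr_sum big_mkcond /= !big_distrr /=.
  rewrite -sum1_size natr_sum big_distrr /= -!big_split /=.
  apply: eq_big_seq => z /hr/hk; rewrite mulr1 => <-.
  by case: (z == a).
by rewrite -(eqr_nat algC) !cnt // e0 e1 e2.
Qed.

Lemma natr_card_pairs (R : pzSemiRingType) (T : finType) (r : rel T) :
  #|[set p : T * T | r p.1 p.2]|%:R = \sum_x \sum_y (r x y)%:R :> R.
Proof.
rewrite pair_bigA -sum1_card natr_sum big_mkcond /=.
by apply: eq_bigr => p _; rewrite inE; case: r.
Qed.

(** * Eigenvalues of a graph and its walks *)

Section Graph.
Variable G : sgraph.
Local Notation A := (adjacency_mx G).
Local Notation enumG := (enum 'I_#|G|).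

Lemma adjacency_mx_normal : A \is normalmx.
Proof.
apply: symmetric_normalmx.
  apply/is_hermitianmxP/matrixP => i j.
  by rewrite !mxE expr0 mul1r adj_sym.
by apply/mxOverP => i j; rewrite mxE realn.
Qed.

Lemma adjacency_mx_spectral : exists P d,
  [/\ P \in unitmx, A = invmx P *m diag_mx d *m P
    & perm_eq (spectrum G) [seq d 0 i | i <- enumG]].
Proof.
have uP := spectral_unit A.
have eA := orthomx_spectralP adjacency_mx_normal.
exists (spectralmx A), (spectral_diag A); split=> //.
apply: prod_XsubC_eq; rewrite /spectrum.
case: closed_field_poly_normal => s /=.
rewrite (monicP (char_poly_monic _)) scale1r => <-.
rewrite [in LHS]eA char_poly_conj // char_poly_trig; last first.
  by apply/is_trig_mxP => i j /ltn_eqF; rewrite mxE val_eqE => ->.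
rewrite big_map enumT; apply: eq_bigr => i _.
by rewrite mxE eqxx.
Qed.

Lemma size_spectrum : size (spectrum G) = #|G|.
Proof.
have [P [d [_ _ /perm_size ->]]] := adjacency_mx_spectral.
by rewrite size_map size_enum_ord.
Qed.

Lemma sum_spectrum : \sum_(z <- spectrum G) z = 0.
Proof.
have [P [d [uP eA hd]]] := adjacency_mx_spectral.
rewrite (perm_big _ hd) big_map big_enum /= -mxtrace_diag.
rewrite -[diag_mx d](mulmxK uP) mxtrace_mulC mulmxA -eA.
by apply: big1 => i _; rewrite mxE adj_irrefl.
Qed.

(** Oriented edges: each edge counts twice, as in the trace of A^2. *)
Definition darts := [set p : G * G | adj p.1 p.2].

(** A walk x, u, v, y is encoded by its inner vertices (u, v), which may coincide with the ends. *)
Definition walks3 (x y : G) :=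
  [set p : G * G | [&& adj x p.1, adj p.1 p.2 & adj p.2 y]].

Lemma sum_sqr_spectrum : \sum_(z <- spectrum G) z ^+ 2 = #|darts|%:R.
Proof.
have [P [d [uP eA hd]]] := adjacency_mx_spectral.
rewrite (perm_big _ hd) big_map big_enum /=.
have -> : \sum_i d 0 i ^+ 2 = \tr (A *m A).
  have -> : A *m A = invmx P *m (diag_mx d *m diag_mx d) *m P.
    by rewrite eA !mulmxA mulmxK.
  rewrite mxtrace_mulC mulKVmx // mulmx_diag mxtrace_diag.
  by apply: eq_bigr => i _; rewrite mxE expr2.
rewrite (natr_card_pairs _ (@adj G)).
rewrite (reindex (@enum_val _ G)) /=; last exact/onW_bij/enum_val_bij.
apply: eq_bigr => i _; rewrite mxE.
rewrite [RHS](reindex (@enum_val _ G)) /=; last exact/onW_bij/enum_val_bij.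
by apply: eq_bigr => j _; rewrite !mxE -natrM mulnb adj_sym andbb.
Qed.

Lemma adjacency_mx_cube i j :
  (A *m A *m A) i j = #|walks3 (enum_val i) (enum_val j)|%:R.
Proof.
rewrite -mulmxA mxE (natr_card_pairs _
  (fun x y => [&& adj (enum_val i) x, adj x y & adj y (enum_val j)])).
rewrite [RHS](reindex (@enum_val _ G)) /=; last exact/onW_bij/enum_val_bij.
apply: eq_bigr => k _; rewrite [(A *m A) _ _]mxE mulr_sumr.
rewrite [RHS](reindex (@enum_val _ G)) /=; last exact/onW_bij/enum_val_bij.
by apply: eq_bigr => l _; rewrite !mxE -!natrM !mulnb.
Qed.

(** Diagonalization turns A^3 = n A into the same equation for each eigenvalue, and the entries of
    A^3 count walks. *)
Lemma spectrum_cube n :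
  (forall z, z \in spectrum G -> z ^+ 3 = n%:R * z) <->
  (forall x y : G, #|walks3 x y| = n * adj x y)%N.
Proof.
have [P [d [uP eA hd]]] := adjacency_mx_spectral.
have e3 : A *m A *m A = invmx P *m (diag_mx d *m diag_mx d *m diag_mx d) *m P.
  by rewrite [in LHS]eA !mulmxA !mulmxK.
have eD : diag_mx d *m diag_mx d *m diag_mx d = diag_mx (\row_i (d 0 i ^+ 3)).
  rewrite !mulmx_diag; congr diag_mx; apply/rowP => i.
  by rewrite !mxE 2!exprSr expr1.
have eN : n%:R *: diag_mx d = diag_mx (\row_i (n%:R * d 0 i)).
  by rewrite -linearZ; congr diag_mx; apply/rowP => i; rewrite !mxE.
split=> h.
  have e : A *m A *m A = n%:R *: A.
    rewrite e3 [in RHS]eA scalemxAl scalemxAr; congr (_ *m _ *m _).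
    rewrite eD eN; congr diag_mx; apply/rowP => i; rewrite !mxE; apply: h.
    by rewrite (perm_mem hd) map_f // mem_enum.
  move=> x y; apply/eqP; rewrite -(eqr_nat algC); apply/eqP.
  have := adjacency_mx_cube (enum_rank x) (enum_rank y).
  by rewrite !enum_rankK => <-; rewrite e !mxE !enum_rankK natrM.
have e : A *m A *m A = n%:R *: A.
  by apply/matrixP => i j; rewrite adjacency_mx_cube h !mxE natrM.
move: e; rewrite e3 [in RHS]eA scalemxAl scalemxAr.
move=> /(can_inj (mulmxK uP)) /(can_inj (mulKVmx uP)).
rewrite eD eN => e z; rewrite (perm_mem hd) => /mapP[i _ ->].
by have /matrixP/(_ i i) := e; rewrite !mxE eqxx !mulr1n.
Qed.

End Graph.

(** The power sums of order 0 and 2 count vertices and darts; that of order 1 is the trace, zero for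
    every graph. *)
Lemma cospectral_of_walks n (G H : sgraph) : (0 < n)%N ->
    (forall x y : G, #|walks3 x y| = n * adj x y)%N ->
    (forall x y : H, #|walks3 x y| = n * adj x y)%N ->
    #|G| = #|H| -> #|darts G| = #|darts H| ->
  cospectral G H.
Proof.
move=> n0 hG hH e0 e2; apply: (@perm_eq_of_moments n%:R).
- by rewrite pnatr_eq0 -lt0n.
- exact/spectrum_cube.
- exact/spectrum_cube.
- by rewrite !size_spectrum.
- by rewrite !sum_spectrum.
- by rewrite !sum_sqr_spectrum e2.
Qed.

Lemma cospectral_walks n (G H : sgraph) : cospectral G H ->
    (forall x y : H, #|walks3 x y| = n * adj x y)%N ->
  [/\ forall x y : G, (#|walks3 x y| = n * adj x y)%N,
      #|G| = #|H| & #|darts G| = #|darts H|].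
Proof.
move=> GH hH; split.
- apply/spectrum_cube => z; rewrite (perm_mem GH).
  exact: (spectrum_cube H n).2.
- by rewrite -!size_spectrum (perm_size GH).
- apply/eqP; rewrite -(eqr_nat algC) -!sum_sqr_spectrum; apply/eqP.
  exact: perm_big.
Qed.

End Spectrum.

(** * Walks and darts of a complete bipartite graph with isolated vertices *)

Section Biclique.
Variables (G : sgraph) (U W : {set G}).
Hypothesis disjUW : [disjoint U & W].
Hypothesis adjE : forall x y : G,
  adj x y = (x \in U) && (y \in W) || (x \in W) && (y \in U).

(** Walks alternate between [U] and [W]: those of length 3 change sides, and each inner vertex
    ranges freely over its side. *)
Lemma biclique_walks3 (x y : G) : #|walks3 x y| = #|U| * #|W| * adj x y.
Proof.
have dUW z : (z \in U) && (z \in W) = false.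
  by apply/negbTE/negP => /andP[zU zW]; rewrite (disjointFr disjUW zU) in zW.
have -> : walks3 x y =
    if (x \in U) && (y \in W) then setX W U
    else if (x \in W) && (y \in U) then setX U W else set0.
  apply/setP => -[u v]; rewrite /walks3 inE /= !adjE.
  move: (dUW u) (dUW v) (dUW x) (dUW y).
  case xU: (x \in U); case xW: (x \in W) => //=;
  case yU: (y \in U); case yW: (y \in W) => //=; rewrite !inE;
  by case: (u \in U); case: (u \in W); case: (v \in U); case: (v \in W).
rewrite adjE; case: ifP => _ /=; first by rewrite cardsX muln1 mulnC.
by case: ifP => _; rewrite ?cardsX ?cards0 ?muln1 ?muln0.
Qed.

Lemma biclique_darts : #|darts G| = (#|U| * #|W|).*2.
Proof.
have -> : darts G = setX U W :|: setX W U.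
  by apply/setP => -[u v]; rewrite !inE adjE.
rewrite cardsU !cardsX [X in _ - X](_ : _ = 0).
  by rewrite subn0 mulnC addnn.
apply/eqP; rewrite cards_eq0; apply/eqP/setP => -[u v]; rewrite !inE /=.
by case uU: (u \in U); rewrite //= (disjointFr disjUW uU) andbF.
Qed.

End Biclique.

(** * Graphs with the walk and dart counts of a star *)

Section StarStructure.
Variables (G : sgraph) (n : nat).
Hypothesis n_gt0 : 0 < n.
Hypothesis walksG : forall x y : G, #|walks3 x y| = n * adj x y.
Hypothesis dartsG : #|darts G| = n.*2.

Let N (x : G) := [set y | adj x y].

(** A triangle would be a closed walk of length 3 at [x], where the count is [n * adj x x = 0]. *)
Lemma triangle_free (x y z : G) : adj x y -> adj y z -> adj z x = false.
Proof.
move=> xy yz; apply/negP => zx.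
have /eqP := walksG x x; rewrite adj_irrefl muln0 cards_eq0.
move=> /eqP/setP/(_ (y, z)).
by rewrite !inE /= xy yz zx.
Qed.

(* The walks of length 3 along the two orientations of an edge are disjoint
   sets of [n] darts each, so together they exhaust the darts. *)
Lemma darts_edge (x y : G) : adj x y -> darts G = walks3 x y :|: walks3 y x.
Proof.
move=> xy; apply/esym/eqP; rewrite eqEcard; apply/andP; split.
  by apply/subsetP => -[u v]; rewrite !inE /= => /orP[] /and3P[].
rewrite cardsU dartsG !walksG [adj y x]adj_sym xy !muln1.
rewrite [X in _ - X](_ : _ = 0); first by rewrite subn0 addnn.
apply/eqP; rewrite cards_eq0; apply/eqP/setP => -[u v]; rewrite !inE /=.
apply/negP => /andP[/and3P[xu uv _] /and3P[_ _ vx]].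
by rewrite (triangle_free xu uv) in vx.
Qed.

(** The dart (v, y) is the middle of a walk along the edge xu, in one orientation or the other: the
    first closes a triangle x, y, v, the second contains the step from [u] to [v]. *)
Lemma neighbours_join (x y u v : G) :
  adj x y -> adj x u -> adj y v -> adj u v.
Proof.
move=> xy xu yv.
have : (v, y) \in darts G by rewrite inE /= adj_sym.
rewrite (darts_edge xu) !inE /= => /orP[] /and3P[].
  by move=> xv _ _; rewrite adj_sym (triangle_free xy yv) in xv.
by move=> uv _ _.
Qed.

(** By [neighbours_join], the inner vertices of a walk from [x] to [y] can be chosen independently
    in [N x] and [N y]. *)
Lemma card_neighbours (x y : G) : adj x y -> #|N x| * #|N y| = n.
Proof.
move=> xy; have := walksG x y; rewrite xy muln1 => <-.
rewrite -cardsX; apply: eq_card => -[u v]; rewrite !inE /= (adj_sym v).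
apply/andP/and3P => [[xu yv]|[]] //; split=> //.
exact: neighbours_join xy xu yv.
Qed.

(** The degrees at the ends of an edge have prime product [n], so one end has degree [n] and is
    adjacent to all other vertices; any further edge would close a triangle. *)
Lemma prime_star_center : prime n -> #|G| = n.+1 ->
  exists x : G, forall u v, adj u v = (u == x) (+) (v == x).
Proof.
move=> pn cG.
have [x Nx] : exists x : G, #|N x| = n.
  have /card_gt0P[[x y]] : 0 < #|darts G| by rewrite dartsG double_gt0.
  rewrite inE /= => xy; have e := card_neighbours xy.
  have /primeP[_ /(_ #|N x|)] := pn.
  rewrite -{1}e dvdn_mulr // => /(_ isT)/orP[]/eqP ex; last by exists x.
  by exists y; rewrite ex mul1n in e.
have {}Nx : N x = [set~ x].
  apply/eqP; rewrite eqEcard cardsC1 cG /= Nx leqnn andbT.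
  apply/subsetP => y; rewrite !inE => xy.
  by apply: contraTneq xy => ->; rewrite adj_irrefl.
have {Nx} adjx y : adj x y = (y != x) by have /setP/(_ y) := Nx; rewrite !inE.
exists x => u v.
have [->|ux] := eqVneq u x; first by rewrite adjx.
have [->|vx] := eqVneq v x; first by rewrite adj_sym adjx.
rewrite -adjx adj_sym in ux; rewrite -adjx in vx.
by rewrite adj_sym (triangle_free ux vx).
Qed.

End StarStructure.

(** Adjacency depends only on which vertex is the center, so any bijection works once a
    transposition sends [x] to [y]. *)
Lemma star_isomorphic (G H : sgraph) (x : G) (y : H) : #|G| = #|H| ->
    (forall u v, adj u v = (u == x) (+) (v == x)) ->
    (forall u v, adj u v = (u == y) (+) (v == y)) ->
  isomorphic G H.
Proof.
move=> e adjG adjH.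
pose f0 (u : G) : H := enum_val (cast_ord e (enum_rank u)).
pose f u := tperm (f0 x) y (f0 u).
have fI : injective f.
  by move=> u v /perm_inj/enum_val_inj/cast_ord_inj/enum_rank_inj.
exists f; first by apply: inj_card_bij fI _; rewrite e.
have fx : f x = y by rewrite /f tpermL.
by move=> u v; rewrite adjG adjH -fx !(inj_eq fI).
Qed.

(** * The star as a complete bipartite graph *)

Section Star.
Variable n : nat.
Let c : star n := inl ord0.

Lemma adj_star (u v : star n) : adj u v = (u == c) (+) (v == c).
Proof. by case: u v => [u|u] [v|v] //=; rewrite ?(ord1 u) ?(ord1 v). Qed.

Lemma card_star : #|star n| = n.+1.
Proof. by rewrite card_sum !card_ord. Qed.

Lemma disjoint_star : [disjoint [set c] & [set~ c]].
Proof. by rewrite -setI_eq0 setICr. Qed.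

Lemma adj_star_biclique (u v : star n) :
  adj u v = (u \in [set c]) && (v \in [set~ c])
            || (u \in [set~ c]) && (v \in [set c]).
Proof. by rewrite adj_star !inE; case: (u == c); case: (v == c). Qed.

Lemma walks3_star (u v : star n) : #|walks3 u v| = n * adj u v.
Proof.
rewrite (biclique_walks3 disjoint_star adj_star_biclique).
by rewrite cards1 cardsC1 card_star mul1n.
Qed.

Lemma darts_star : #|darts (star n)| = n.*2.
Proof.
rewrite (biclique_darts disjoint_star adj_star_biclique).
by rewrite cards1 cardsC1 card_star mul1n.
Qed.

End Star.

(** * Cospectral mates of the star for composite n *)

Section BicliqueWithIsolated.
Variables a b m : nat.
Let U := [set i : 'I_m | i < a].
Let W := [set i : 'I_m | a <= i < a + b].
Let e : rel 'I_m := fun i j => (i \in U) && (j \in W) || (i \in W) && (j \in U).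
Let disjUW : [disjoint U & W].
Proof.
rewrite -setI_eq0; apply/eqP/setP => i; rewrite !inE.
by rewrite [a <= i]leqNgt; case: (i < a).
Qed.
Let e_sym : symmetric e.
Proof. by move=> i j; rewrite /e orbC ![_ && (i \in _)]andbC. Qed.
Let e_irrefl : irreflexive e.
Proof.
move=> i; rewrite /e; case iU: (i \in U) => //=; last by rewrite andbF.
by rewrite (disjointFr disjUW iU).
Qed.

(** For [a + b <= m] this is K_{a,b} with the remaining, last indices as isolated vertices. *)
Definition biclique_isolated : sgraph := SGraph e_sym e_irrefl.

Hypothesis le_abm : a + b <= m.

Let card_lt k : k <= m -> #|[set i : 'I_m | i < k]| = k.
Proof.
move=> km; rewrite -sum1_card (eq_bigl (fun i : 'I_m => i < k)); last first.
  by move=> i; rewrite inE.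
by rewrite -(big_ord_widen _ (fun _ => 1)) // sum1_card card_ord.
Qed.

Let cardU : #|U| = a.
Proof. by apply: card_lt; apply: leq_trans le_abm; apply: leq_addr. Qed.

Let cardW : #|W| = b.
Proof.
have -> : W = [set i : 'I_m | i < a + b] :\: U.
  by apply/setP => i; rewrite !inE -leqNgt.
rewrite cardsD (setIidPr _); last first.
  by apply/subsetP => i; rewrite !inE => /ltn_addr.
by rewrite cardU card_lt // addKn.
Qed.

Lemma biclique_isolated_walks3 (x y : biclique_isolated) :
  #|walks3 x y| = a * b * adj x y.
Proof. by rewrite (@biclique_walks3 biclique_isolated U W) // cardU cardW. Qed.

Lemma biclique_isolated_darts : #|darts biclique_isolated| = (a * b).*2.
Proof. by rewrite (@biclique_darts biclique_isolated U W) // cardU cardW. Qed.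

Lemma biclique_isolated_last (x y : biclique_isolated) :
  a + b <= x -> adj x y = false.
Proof.
move=> abx; have ax := leq_trans (leq_addr b a) abx.
by rewrite /= /e !inE [x < a]ltnNge [x < a + b]ltnNge ax abx.
Qed.

End BicliqueWithIsolated.

(* n = 1 is excluded: the star with one leaf is the complete graph on two
   vertices, which is determined by its spectrum although 1 is not prime. *)
Theorem theorem5p3 (n : nat) (hn : 1 < n) :
  determined_by_spectrum (star n) <-> prime n.
Proof.
split=> [ds|pn G cG]; last first.
  have [hw hc hd] := cospectral_walks cG (@walks3_star n).
  rewrite card_star in hc; rewrite darts_star in hd.
  have [x hx] := prime_star_center (ltnW hn) hw hd pn hc.
  by apply: star_isomorphic hx (@adj_star n); rewrite card_star.
apply: contraT => /primePn[|[a /andP[a1 an] /dvdnP[b nE]]].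
  by rewrite ltnNge hn.
have b1 : 1 < b by case: b nE an => [|[|b]] ->; rewrite ?mul1n ?ltnn.
(* Indeed ab - a - b = (a - 1)(b - 1) - 1 >= 0, so at least one of the n + 1 vertices is left
   isolated. *)
have leab : a + b <= n.
  have a0 : 0 < a.-1 by rewrite -ltnS prednK // ltnW.
  by rewrite nE -(prednK (ltnW a1)) mulnS addnC leq_add2l ltn_Pmull.
have lab : a + b <= n.+1 by exact: leqW.
have [] := ds (biclique_isolated a b n.+1).
  apply: (@cospectral_of_walks n) => [||||]; first exact: ltnW.
  - by move=> x y; rewrite biclique_isolated_walks3 // [a * b]mulnC -nE.
  - exact: walks3_star.
  - by rewrite card_star card_ord.
  - by rewrite darts_star biclique_isolated_darts // [a * b]mulnC -nE.
move=> f [g fK gK] hf.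
(* The last index is [n], at least [a + b], so its vertex is isolated, while every vertex of the
   star has a neighbour. *)
have h (w : star n) : adj (f ord_max) w = false.
  by rewrite -[w]gK hf biclique_isolated_last.
by case: (f ord_max) h => z;
  [move/(_ (inr (Ordinal (ltnW hn)))) | move/(_ (inl ord0))].
Qed.
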